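(* For all integers $p_1,p_2,q>1$, \begin{align*} &(1+(-1)^{p_1+p_2+q})\hat S_{p_1p_2,q}\\ &=-(-1)^{p_1+p_2}(1+(-1)^q)\widetilde{t}(p_1)\widetilde{t}(p_2)\zeta(q)+(-1)^{p_1}((-1)^{p_2+q}-1)\widetilde{t}(p_1)\hat S_{p_2,q}+(-1)^{p_2}((-1)^{p_1+q}-1)\widetilde{t}(p_2)\hat S_{p_1,q}\\ &\quad-(-1)^{p_1+p_2}\sum_{\substack{k_1+k_2=q+2\\ k_1,k_2\geq 1}} \binom{k_1+p_1-2}{p_1-1}\binom{k_2+p_2-2}{p_2-1}\widetilde{t}(k_1+p_1-1)\widetilde{t}(k_2+p_2-1)\\ &\quad+2(-1)^{p_1+p_2}\sum_{\substack{k_1+k_2+2k_3=q+2\\ k_1,k_2,k_3\geq 1}}\binom{k_1+p_1-2}{p_1-1}\binom{k_2+p_2-2}{p_2-1}\widetilde{t}(k_1+p_1-1)\widetilde{t}(k_2+p_2-1)\zeta(2k_3)\\ &\quad-(-1)^{p_1+p_2}\sum_{l=0}^{p_1+p_2-1}((-1)^l-1)\binom{p_1+p_2+q-l-2}{q-1}\widetilde{t}(l+1)\widetilde{t}(p_1+p_2+q-l-1)\\ &\quad+(-1)^{p_1+p_2}\sum_{k=1}^{p_2}(-1)^k\binom{k+p_1-2}{p_1-1}\sum_{l=0}^{p_2-k}((-1)^l-1)\binom{p_2+q-k-l-1}{q-1}\widetilde{t}(l+1)\\ &\qquad\times\left(\zeta(k+p_1-1)\widetilde{t}(p_2+q-k-l)+(-1)^{k+p_1-1}\sum_{n=1}^\infty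 \frac{H_{n-1}^{(k+p_1-1)}}{(n-1/2)^{p_2+q-k-l}} \right)\\ &\quad+(-1)^{p_1+p_2}\sum_{k=1}^{p_1} (-1)^k\binom{k+p_2-2}{p_2-1}\sum_{l=0}^{p_1-k}((-1)^l-1)\binom{p_1+q-k-l-1}{q-1}\widetilde{t}(l+1)\\ &\qquad\times\left(\zeta(k+p_2-1)\widetilde{t}(p_1+q-k-l)+(-1)^{k+p_2-1}\sum_{n=1}^\infty \frac{H_{n-1}^{(k+p_2-1)}}{(n-1/2)^{p_1+q-k-l}} \right). \end{align*}
   Context: Let $h_n^{(p)}=\sum_{k=1}^n (k-1/2)^{-p}$ and $H_n^{(p)}=\sum_{k=1}^n k^{-p}$ (empty sums are $0$). Define $\hat S_{p,q}=\sum_{n\ge1}\frac{h_n^{(p)}}{n^q}$ and $\hat S_{p_1p_2,q}=\sum_{n\ge1}\frac{h_n^{(p_1)}h_n^{(p_2)}}{n^q}$. For $s>1$, $\widetilde t(s)=\sum_{n\ge1}(n-1/2)^{-s}=(2^s-1)\zeta(s)$; $\zeta$ is the Riemann zeta function; terms with $\widetilde t(1)$ occur only with coefficient $0$. *)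

(* Defs.v *)
From HB Require Import structures.
From mathcomp Require Import all_boot all_order all_algebra.
From mathcomp Require Import all_classical all_reals all_analysis.
Set Implicit Arguments.
Unset Strict Implicit.
Unset Printing Implicit Defensive.
Import Order.TTheory GRing.Theory Num.Theory.
Import numFieldNormedType.Exports.
Local Open Scope ring_scope.

Notation "\sum_ ( m <= i <oo ) F" :=
  (\big[+%R/0%R]_(m <= i <oo) F%R) : ring_scope.

Section Defs.
Variable R : realType.
Implicit Types p q s n : nat.

Definition harmonic_sum p n : R := \sum_(1 <= k < n.+1) k%:R ^- p.

Definition half_harmonic_sum p n : R := \sum_(1 <= k < n.+1) (k%:R - 2^-1) ^- p.

(* The limits below carry no meaning when the last argument is 0 or 1, where the
   series diverge. *)
Definition zeta s : R := \sum_(1 <= n <oo) (n%:R ^- s : R).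

Definition ttilde s : R := \sum_(1 <= n <oo) ((n%:R - 2^-1) ^- s : R).

Definition Shat p q : R := \sum_(1 <= n <oo) (half_harmonic_sum p n / n%:R ^+ q).

Definition Shat2 p1 p2 q : R :=
  \sum_(1 <= n <oo) (half_harmonic_sum p1 n * half_harmonic_sum p2 n / n%:R ^+ q).

End Defs.

(* Main.v *)
Require Import Defs.
From mathcomp Require Import all_boot all_order all_algebra.
From mathcomp Require Import all_classical all_reals all_analysis.
From mathcomp Require Import ring lra zify.
Set Implicit Arguments.
Unset Strict Implicit.
Unset Printing Implicit Defensive.
Import Order.TTheory GRing.Theory Num.Theory.
Import numFieldNormedType.Exports.
Local Open Scope classical_set_scope.
Local Open Scope ring_scope.

(** The sum [F p (s) = \sum_a (a - s) ^ (-p)] over the positive half-integers [a]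
    equals [ttilde p + (-1) ^ p h_n] at [s = n] and [ttilde p - h_n] at [s = - n].
    Hence the sum of [F p1 (n) * F p2 (n) / n ^ q] over the nonzero integers [n]
    is a combination of the Euler sums of the theorem, and it remains to compute
    it in another way.  Truncating [F] to [a < M], it is a finite sum over [a] and
    [b] of the sums of [(a - n) ^ (-p1) * (b - n) ^ (-p2) * n ^ (-q)] over [n].
    What the classical proof obtains from the residues at [0], [a] and [b] of this
    function times [pi cot (pi s)] is obtained here from exact identities for the
    symmetric partial sums [0 < |n| < N]: both the partial sum and its
    contribution from the pole [0] satisfy
    [(a - b) T p1.+1 p2.+1 = T p1 p2.+1 - T p1.+1 p2], so the difference is
    determined by its values on the axes, with binomial coefficients.  Then [N]
    and, by Tannery's theorem, [M] go to infinity. *)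

(** * Recursions of Pascal type on the quadrant *)

Section PascalRecursion.
Variables (F : fieldType) (c : F).
Implicit Types (U : nat -> F) (T : nat -> nat -> F).

(** The principal part at [s = c] of [(c - s) ^- p * s ^- q], with [U r] in place of [(c - s) ^- r].
    At [q = 0] the truncated predecessor gives the coefficient 1 for [i = 0] and 0 otherwise, as it
    should. *)
Definition pole_part p q U : F :=
  \sum_(i < p) 'C((q + i).-1, i)%:R * c ^- (q + i) * U (p - i)%N.

Hypothesis c0 : c != 0.

(** Once the matching [i = 0] terms are removed, this is Pascal's rule for the coefficients. *)
Lemma pole_part_rec p q U :
  c * pole_part p.+1 q.+1 U = pole_part p.+1 q U + pole_part p q.+1 U.
Proof.
have cV n : c * c ^- n.+1 = c ^- n by rewrite exprS invfM mulrA divff// mul1r.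
rewrite /pole_part mulr_sumr big_ord_recl [in RHS]big_ord_recl -addrA; congr (_ + _).
  by rewrite !addn0 !bin0 !mul1r mulrA cV.
rewrite -big_split/=; apply: eq_bigr => i _; rewrite /bump !add1n subSS.
rewrite !addnS !addSn /= binS natrD -(cV (q + i).+1).
by ring.
Qed.

Lemma pole_partn0 p U : pole_part p.+1 0 U = U p.+1.
Proof.
rewrite /pole_part big_ord_recl big1 => [|i _]; last first.
  by rewrite /bump/= bin_small ?mul0r.
by rewrite bin0 expr0 invr1 subn0 !mul1r addr0.
Qed.

Lemma pole_part0n q U : pole_part 0 q U = 0.
Proof. by rewrite /pole_part big_ord0. Qed.

(** Both sides obey the same recursion and agree on the two axes, so induction on [p + q] applies.
    The recursion never reaches the origin and [pole_part] never evaluates [U 0], so [T 0 0] does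
    not enter. *)
Lemma pascal_recursion T :
    (forall p q, c * T p.+1 q.+1 = T p.+1 q + T p q.+1) ->
  forall p q, (0 < p + q)%N ->
  T p q = pole_part p q (T^~ 0%N) + pole_part q p (T 0%N).
Proof.
move=> Trec p q; have [n] := ubnP (p + q)%N; elim: n p q => // n IHn.
case=> [|p] [|q]//; rewrite ?pole_partn0 ?pole_part0n ?add0r ?addr0//.
move=> lt_n _; apply: (mulfI c0); rewrite Trec mulrDr !pole_part_rec.
by rewrite !IHn ?addnS//; [ring | lia | lia].
Qed.

End PascalRecursion.

Lemma invrXN (F : fieldType) (x : F) n : (- x) ^- n = (-1) ^+ n * x ^- n.
Proof. by rewrite [in LHS]exprNn invfM -exprVn invrN1. Qed.

(** The twist [(-1) ^+ q * D p q] turns the difference into a sum, so that [pascal_recursion]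
    applies with [c = a - b]. Undoing the twist produces the alternating signs and the powers of
    [b - a]. *)
Lemma signed_pascal_recursion (F : fieldType) (a b : F) (D : nat -> nat -> F) :
    a != b ->
    (forall p q, (a - b) * D p.+1 q.+1 = D p q.+1 - D p.+1 q) ->
  forall p q, (0 < p + q)%N ->
  D p q =
    \sum_(i < p) (-1) ^+ i * 'C((q + i).-1, i)%:R * (b - a) ^- (q + i)
                 * D (p - i)%N 0%N
  + \sum_(j < q) (-1) ^+ j * 'C((p + j).-1, j)%:R * (a - b) ^- (p + j)
                 * D 0%N (q - j)%N.
Proof.
move=> ab Drec p q pq_gt0.
have c0 : a - b != 0 by rewrite subr_eq0.
pose T p q : F := (-1) ^+ q * D p q.
have Trec p' q' : (a - b) * T p'.+1 q'.+1 = T p'.+1 q' + T p' q'.+1.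
  by rewrite /T mulrCA Drec exprS; ring.
have := pascal_recursion c0 Trec pq_gt0; rewrite /T.
move/(congr1 ( *%R ((-1) ^+ q))); rewrite mulrA -expr2 sqrr_sign mul1r => ->.
rewrite mulrDr /pole_part !mulr_sumr; congr (_ + _); apply: eq_bigr => i _.
  rewrite expr0 mul1r -[b - a]opprB invrXN [(-1) ^+ (q + i)]exprD.
  have := sqrr_sign F i; move: ((-1) ^+ i) ((-1) ^+ q) => e e' ee.
  by rewrite -[LHS]mul1r -[X in X * _]ee; ring.
have -> : (-1) ^+ i = (-1) ^+ q * (-1) ^+ (q - i) :> F.
  rewrite -exprD -[RHS]signr_odd -[LHS]signr_odd; congr (_ ^+ _).
  by rewrite oddD oddB ?(ltnW (ltn_ord i))// addbA addbb.
by ring.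
Qed.

(** * Taylor coefficients at 0 and the contribution of the pole 0 *)

Section TaylorCoefficients.
Variable F : fieldType.
Implicit Types (a b : F) (u v Z : nat -> F).

(* the coefficient of [s ^ j] in the expansion of [(a - s) ^ (-p)] at [s = 0] *)
Definition taylor a p j : F := 'C((p + j).-1, j)%:R * a ^- (p + j).

Definition conv u v j : F := \sum_(i < j.+1) u i * v (j - i)%N.

(* minus the residue at [0] of [pi cot (pi s) u(s) / s ^ q] when [Z i] is the sum
   of [n ^ (-i)] over the nonzero integers [n] *)
Definition res0 Z q u : F := - u q + \sum_(j < q) u j * Z (q - j)%N.

Lemma taylor_rec0 a p : a != 0 -> a * taylor a p.+1 0 = taylor a p 0.
Proof.
move=> a0; rewrite /taylor !addn0 !bin0 !mul1r.
by rewrite exprS invfM mulrA divff// mul1r.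
Qed.

Lemma taylor_recS a p j : a != 0 ->
  a * taylor a p.+1 j.+1 = taylor a p.+1 j + taylor a p j.+1.
Proof.
move=> a0; rewrite /taylor !addnS !addSn /= binS natrD.
have -> : a ^- (p + j).+1 = a * a ^- (p + j).+2.
  by rewrite [in RHS]exprS invfM mulrA divff// mul1r.
by ring.
Qed.

Lemma taylor0 a j : taylor a 0 j = (j == 0%N)%:R.
Proof.
case: j => [|j]; first by rewrite /taylor bin0 expr0 invr1 mulr1.
by rewrite /taylor add0n bin_small ?mul0r.
Qed.

Lemma convC u v j : conv u v j = conv v u j.
Proof.
rewrite /conv (reindex_inj rev_ord_inj)/=; apply: eq_bigr => i _.
by rewrite mulrC subSS subKn // -ltnS.
Qed.

Lemma conv_taylor0 u b j : conv u (taylor b 0) j = u j.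
Proof.
rewrite /conv big_ord_recr/= subnn taylor0 eqxx mulr1 big1 ?add0r// => i _.
by rewrite taylor0 subn_eq0 leqNgt ltn_ord mulr0.
Qed.

Lemma conv_taylor_rec0 a p v : a != 0 ->
  a * conv (taylor a p.+1) v 0 = conv (taylor a p) v 0.
Proof. by move=> a0; rewrite /conv !big_ord1 mulrA taylor_rec0. Qed.

Lemma conv_taylor_recS a p v j : a != 0 ->
  a * conv (taylor a p.+1) v j.+1
  = conv (taylor a p.+1) v j + conv (taylor a p) v j.+1.
Proof.
move=> a0; rewrite /conv big_ord_recl [X in _ = _ + X]big_ord_recl.
rewrite mulrDr mulrA taylor_rec0// addrCA; congr (_ + _).
rewrite mulr_sumr -big_split; apply: eq_bigr => i _ /=.
by rewrite /bump add1n subSS mulrA taylor_recS// mulrDl.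
Qed.

Lemma eq_res0 Z q u v : (forall j, (j <= q)%N -> u j = v j) ->
  res0 Z q u = res0 Z q v.
Proof.
move=> uv; rewrite /res0 uv//; congr (_ + _); apply: eq_bigr => i _.
by rewrite uv// ltnW.
Qed.

(** Coefficient form of [a = (a - s) + s]: the factor [a - s] lowers [p], and the factor [s] shifts
    the coefficients by one, which lowers [q]. *)
Lemma res0_conv_taylor_rec Z a p v q : a != 0 ->
  a * res0 Z q.+1 (conv (taylor a p.+1) v)
  = res0 Z q (conv (taylor a p.+1) v) + res0 Z q.+1 (conv (taylor a p) v).
Proof.
move=> a0; rewrite /res0 mulrDr mulrN conv_taylor_recS// !big_ord_recl.
rewrite mulrDr mulrA conv_taylor_rec0// mulr_sumr.
under [in LHS]eq_bigr => i _ do rewrite lift0 mulrA conv_taylor_recS// mulrDl subSS.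
rewrite big_split/=.
under [X in _ = _ + (_ + (_ + X))]eq_bigr => i _ do rewrite /bump add1n subSS.
by rewrite !subn0; ring.
Qed.

(** Coefficient form of [a - b = (a - s) - (b - s)]: the shifted terms produced by [a] and by [b]
    cancel. *)
Lemma res0_conv_taylor_sub Z a b p1 p2 q : a != 0 -> b != 0 ->
  (a - b) * res0 Z q (conv (taylor a p1.+1) (taylor b p2.+1))
  = res0 Z q (conv (taylor a p1) (taylor b p2.+1))
    - res0 Z q (conv (taylor a p1.+1) (taylor b p2)).
Proof.
move=> a0 b0.
have E j : (a - b) * conv (taylor a p1.+1) (taylor b p2.+1) j
    = conv (taylor a p1) (taylor b p2.+1) j
      - conv (taylor a p1.+1) (taylor b p2) j.
  rewrite mulrBl [X in b * X]convC [X in _ = _ - X]convC.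
  case: j => [|j]; first by rewrite !conv_taylor_rec0.
  by rewrite !conv_taylor_recS// (convC (taylor b _) (taylor a _) j); ring.
rewrite /res0 mulrDr mulrN E mulr_sumr opprD opprK.
under eq_bigr => i _ do rewrite mulrA E mulrBl.
by rewrite sumrB; ring.
Qed.

Lemma res0_delta Z q b : res0 Z q.+1 (taylor b 0) = Z q.+1.
Proof.
rewrite /res0 big_ord_recl !taylor0 /= mul1r subn0 big1 ?addr0 ?oppr0 ?add0r//.
by move=> i _; rewrite taylor0 mul0r.
Qed.

End TaylorCoefficients.

(** * Exact evaluation of symmetric partial sums with two poles off the lattice *)

Section TwoPoleSums.
Variables (F : numFieldType) (N : nat).
Implicit Types (a b s : F).

(** Pairing [n] with [- n] is what makes the sums of order 1 converge later. *)
Definition sum_pm (f : F -> F) : F := \sum_(1 <= n < N) (f n%:R + f (- n%:R)).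

Definition pole_sum a b p1 p2 q : F :=
  sum_pm (fun s => (a - s) ^- p1 * (b - s) ^- p2 * s ^- q).

(** Unlike [pole_sum], this includes the point 0; at [q = 0] its term is supplied by the summand
    [- u q] of [res0]. *)
Definition lattice_sum a p : F := a ^- p + sum_pm (fun s => (a - s) ^- p).

Definition power_sum q : F := sum_pm (fun s => s ^- q).

Definition off_lattice a := a != 0 /\
  forall n, (0 < n < N)%N -> a != n%:R /\ a != - n%:R.

Lemma eq_sum_pm f g : (forall n, (0 < n < N)%N ->
  f n%:R = g n%:R /\ f (- n%:R) = g (- n%:R)) -> sum_pm f = sum_pm g.
Proof. by move=> fg; apply: eq_big_nat => n /fg[-> ->]. Qed.

Lemma sum_pmD f g : sum_pm (fun s => f s + g s) = sum_pm f + sum_pm g.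
Proof. by rewrite /sum_pm -big_split; apply: eq_bigr => n _ /=; ring. Qed.

Lemma sum_pmZ k f : sum_pm (fun s => k * f s) = k * sum_pm f.
Proof. by rewrite /sum_pm mulr_sumr; apply: eq_bigr => n _; ring. Qed.

Let invXS (x : F) n : x != 0 -> x ^- n = x * x ^- n.+1.
Proof. by move=> x0; rewrite exprS invfM mulrA divff// mul1r. Qed.

(** Termwise [a = (a - s) + s]. *)
Lemma pole_sum_recS a b p1 p2 q : off_lattice a ->
  a * pole_sum a b p1.+1 p2 q.+1 =
  pole_sum a b p1.+1 p2 q + pole_sum a b p1 p2 q.+1.
Proof.
move=> [a0 aN]; rewrite -sum_pmZ -sum_pmD; apply: eq_sum_pm => n n0.
have [an am] := aN n n0.
have n1 : n%:R != 0 :> F by rewrite pnatr_eq0; lia.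
have n2 : - n%:R != 0 :> F by rewrite oppr_eq0.
have a1 : a - n%:R != 0 by rewrite subr_eq0.
have a2 : a - - n%:R != 0 by rewrite subr_eq0.
by split; rewrite !(@invXS _ p1)// !(@invXS _ q)//; ring.
Qed.

(** Termwise [a - b = (a - s) - (b - s)]. *)
Lemma pole_sum_sub a b p1 p2 q : off_lattice a -> off_lattice b ->
  (a - b) * pole_sum a b p1.+1 p2.+1 q =
  pole_sum a b p1 p2.+1 q - pole_sum a b p1.+1 p2 q.
Proof.
move=> [a0 aN] [b0 bN]; rewrite -[- pole_sum _ _ _ _ _]mulN1r -!sum_pmZ -sum_pmD.
apply: eq_sum_pm => n n0.
have [an am] := aN n n0.
have [bn bm] := bN n n0.
have a1 : a - n%:R != 0 by rewrite subr_eq0.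
have a2 : a - - n%:R != 0 by rewrite subr_eq0.
have b1 : b - n%:R != 0 by rewrite subr_eq0.
have b2 : b - - n%:R != 0 by rewrite subr_eq0.
by split; rewrite !(@invXS _ p1)// !(@invXS _ p2)//; ring.
Qed.

(** The part of the partial sum due to the poles [a] and [b]. It inherits the recursions shared by
    its two terms, and its values on the axes are explicit. *)
Definition regular_sum a b p1 p2 q : F :=
  pole_sum a b p1 p2 q
  - res0 power_sum q (conv (taylor a p1) (taylor b p2)).

Lemma regular_sumC a b p1 p2 q :
  regular_sum a b p1 p2 q = regular_sum b a p2 p1 q.
Proof.
congr (_ - _); first by apply: eq_sum_pm => n _; split; congr (_ * _); rewrite mulrC.
by apply: eq_res0 => j _; rewrite convC.
Qed.

(** Apply [pascal_recursion] in [(p, q)]: the axis [p = 0] contributes 0, and the axis [q = 0]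
    contributes [lattice_sum]. *)
Lemma regular_sum_one_pole a b p q : off_lattice a ->
  (0 < p + q)%N ->
  regular_sum a b p 0 q = pole_part a p q (lattice_sum a).
Proof.
move=> La pq; have a0 := La.1.
(* Here 0 is the only pole, and [res0] accounts for all of [power_sum]. *)
have R0 q' : regular_sum a b 0 0 q'.+1 = 0.
  rewrite /regular_sum (@eq_res0 _ _ _ _ (taylor a 0)) => [|j _]; last first.
    by rewrite conv_taylor0.
  rewrite res0_delta; apply/eqP; rewrite subr_eq0; apply/eqP.
  by apply: eq_sum_pm => n _; rewrite !expr0 invr1 !mul1r.
have Rp p' : regular_sum a b p' 0 0 = lattice_sum a p'.
  rewrite /regular_sum /res0 big_ord0 addr0 opprK conv_taylor0 addrC.
  congr (_ + _); first by rewrite /taylor addn0 bin0 mul1r.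
  by apply: eq_sum_pm => n _; rewrite !expr0 invr1 !mulr1.
pose T p' q' := regular_sum a b p' 0 q'.
have Trec p' q' : a * T p'.+1 q'.+1 = T p'.+1 q' + T p' q'.+1.
  rewrite /T /regular_sum mulrBr pole_sum_recS// res0_conv_taylor_rec//.
  by ring.
rewrite -/(T p q) (pascal_recursion a0 Trec pq) /T.
rewrite [X in _ + X]big1 ?addr0 => [|i _].
  by apply: eq_bigr => i _; rewrite Rp.
by rewrite -(subnSK (ltn_ord i)) R0 mulr0.
Qed.

(** When [a = b] the left side of the difference recursion vanishes, so a unit of exponent can be
    moved from the second factor to the first. *)
Lemma regular_sum_diag a p1 p2 q : off_lattice a ->
  regular_sum a a p1 p2 q = regular_sum a a (p1 + p2) 0 q.
Proof.
move=> La; elim: p2 p1 => [|p2 IH] p1; first by rewrite addn0.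
rewrite addnS -addSn -IH; apply/eqP; rewrite -subr_eq0; apply/eqP.
have := pole_sum_sub p1 p2 q La La.
have := res0_conv_taylor_sub power_sum p1 p2 q La.1 La.1.
rewrite subrr !mul0r /regular_sum => /esym/subr0_eq-> /esym/subr0_eq->.
by rewrite subrr.
Qed.

Lemma pole_sum_diag a p1 p2 q : off_lattice a -> (0 < p1)%N ->
  pole_sum a a p1 p2 q =
    res0 power_sum q (conv (taylor a p1) (taylor a p2))
    + pole_part a (p1 + p2) q (lattice_sum a).
Proof.
move=> La p10; rewrite -(@regular_sum_one_pole a a) ?addn_gt0 ?p10//.
by rewrite -regular_sum_diag// addrC subrK.
Qed.

(** For fixed [q] the regular sum satisfies the signed recursion in [(p1, p2)]; on each axis only
    one pole is left, where [regular_sum_one_pole] applies. *)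
Lemma pole_sum_offdiag a b p1 p2 q : off_lattice a -> off_lattice b ->
  a != b -> (0 < p1)%N ->
  pole_sum a b p1 p2 q =
    res0 power_sum q (conv (taylor a p1) (taylor b p2))
  + \sum_(i < p1) (-1) ^+ i * 'C((p2 + i).-1, i)%:R * (b - a) ^- (p2 + i)
                 * pole_part a (p1 - i) q (lattice_sum a)
  + \sum_(j < p2) (-1) ^+ j * 'C((p1 + j).-1, j)%:R * (a - b) ^- (p1 + j)
                 * pole_part b (p2 - j) q (lattice_sum b).
Proof.
move=> La Lb ab p10.
have Drec p p' : (a - b) * regular_sum a b p.+1 p'.+1 q =
    regular_sum a b p p'.+1 q - regular_sum a b p.+1 p' q.
  rewrite /regular_sum mulrBr pole_sum_sub// res0_conv_taylor_sub ?La.1 ?Lb.1//.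
  by ring.
pose D p p' := regular_sum a b p p' q.
have /(_ p1 p2) := @signed_pascal_recursion F a b D ab Drec.
rewrite addn_gt0 p10 /D => /(_ isT) H.
rewrite -[LHS](subrK (res0 power_sum q (conv (taylor a p1) (taylor b p2)))).
rewrite addrC -[_ - _]/(regular_sum _ _ _ _ _) H [LHS]addrA; congr (_ + _ + _).
  apply: eq_bigr => i _; rewrite regular_sum_one_pole//.
  by rewrite addn_gt0 subn_gt0 ltn_ord.
apply: eq_bigr => i _; rewrite regular_sumC regular_sum_one_pole//.
by rewrite addn_gt0 subn_gt0 ltn_ord.
Qed.

End TwoPoleSums.

(** * Series indexed from 1, dominated convergence and Tannery's theorem *)

Section SeriesFromOne.
Variable R : realType.
Implicit Types (u v c : nat -> R) (l : R).

(** The exclusive bound makes [limn (psum u)] the series [\sum_(1 <= n <oo) u n] by definition. *)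
Definition psum u N : R := \sum_(1 <= n < N) u n.

Lemma eventually_eq_cvg u v l K : (forall n, (K <= n)%N -> u n = v n) ->
  u @ \oo --> l -> v @ \oo --> l.
Proof.
move=> uv; apply: cvg_trans; apply: near_eq_cvg.
by exists K => // n /= Kn; rewrite uv.
Qed.

Lemma cvg_sum_ord n (f : nat -> 'I_n -> R) (g : 'I_n -> R) :
    (forall i, f ^~ i @ \oo --> g i) ->
  \sum_(i < n) f x i @[x --> \oo] --> \sum_(i < n) g i.
Proof.
move=> fg; apply: (@cvg_big R _ +%R 0 xpredT _ _ \oo _ (fun i x => f x i)) => //.
exact: add_continuous.
Qed.

Lemma cvg_sum_nat m n (f : nat -> nat -> R) (g : nat -> R) :
    (forall i, (m <= i < n)%N -> f ^~ i @ \oo --> g i) ->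
  \sum_(m <= i < n) f x i @[x --> \oo] --> \sum_(m <= i < n) g i.
Proof.
move=> fg; under eq_fun do rewrite big_nat; rewrite big_nat.
apply: (@cvg_big R _ +%R 0 _ _ _ \oo _ (fun i x => f x i)) => //.
exact: add_continuous.
Qed.

Lemma psum_mono u m n : (forall i, (0 < i)%N -> 0 <= u i) -> (m <= n)%N ->
  psum u m <= psum u n.
Proof.
move=> u0 mn; have [m0|m0] := posnP m.
  rewrite m0 /psum big_geq// big_nat; apply: sumr_ge0 => i.
  by case/andP => i0 _; apply: u0.
rewrite /psum (big_cat_nat m0 mn)/= lerDl big_nat.
by apply: sumr_ge0 => i /andP[mi _]; apply: u0; apply: leq_trans mi.
Qed.

Lemma psum_le u v n : (forall i, (0 < i)%N -> u i <= v i) -> psum u n <= psum v n.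
Proof. by move=> uv; apply: ler_sum_nat => i /andP[/uv]. Qed.

Lemma psum_le_lim u n : (forall i, (0 < i)%N -> 0 <= u i) -> cvgn (psum u) ->
  psum u n <= limn (psum u).
Proof.
move=> u0 cu; apply: nondecreasing_cvgn_le => // a b ab; exact: psum_mono.
Qed.

Lemma psum_nneg_cvg u v : (forall i, (0 < i)%N -> 0 <= u i <= v i) ->
  cvgn (psum v) -> cvgn (psum u).
Proof.
move=> uv cv; apply: nondecreasing_is_cvgn.
  by move=> a b; apply: psum_mono => i /uv/andP[].
exists (limn (psum v)) => _ [n _ <-].
apply: le_trans (psum_le_lim n _ cv); last first.
  by move=> i /uv/andP[]; apply: le_trans.
by apply: psum_le => i /uv/andP[].
Qed.

Lemma psumD u v n : psum (fun i => u i + v i) n = psum u n + psum v n.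
Proof. exact: big_split. Qed.

Lemma psumZ k u n : psum (fun i => k * u i) n = k * psum u n.
Proof. by rewrite /psum mulr_sumr. Qed.

(** Write [u] as the difference of the nonnegative sequences [|u| + u] and [|u|], dominated by
    [2 * |u|] and [c]. *)
Lemma psum_dom_cvg u c : (forall i, (0 < i)%N -> `|u i| <= c i) ->
  cvgn (psum c) -> cvgn (psum u).
Proof.
move=> uc cc.
have cn : cvgn (psum (fun i => `|u i|)).
  by apply: psum_nneg_cvg cc => i /uc ->; rewrite normr_ge0.
have cp : cvgn (psum (fun i => `|u i| + u i)).
  apply: (@psum_nneg_cvg _ (fun i => 2 * `|u i|)) => [i i0|].
    by have := ler_norm (u i); have := ler_norm (- u i); rewrite normrN; lra.
  by rewrite (funext (psumZ 2 (fun i => `|u i|))); apply: is_cvgMl_tmp.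
suff -> : psum u = psum (fun i => `|u i| + u i) - psum (fun i => `|u i|).
  exact: is_cvgB.
by apply/funext => n; rewrite fctE psumD addrAC subrr add0r.
Qed.

Lemma psum_tail u c s l K : (forall i, (0 < i)%N -> `|u i| <= c i) ->
  psum u @ \oo --> s -> psum c @ \oo --> l ->
  `|s - psum u K.+1| <= l - psum c K.+1.
Proof.
move=> uc us cl.
have cu : (`|psum u n - psum u K.+1| @[n --> \oo] --> `|s - psum u K.+1|).
  by apply: cvg_norm; apply: cvgB => //; apply: cvg_cst.
have cc : (psum c n - psum c K.+1 @[n --> \oo] --> l - psum c K.+1).
  by apply: cvgB => //; apply: cvg_cst.
rewrite -(cvg_lim (@Rhausdorff R) cu) -(cvg_lim (@Rhausdorff R) cc).
apply: ler_lim; [exact: cvgP cu | exact: cvgP cc |].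
exists K.+1 => // n /= Kn.
have split w : psum w n - psum w K.+1 = \sum_(K.+1 <= i < n) w i.
  by rewrite /psum (big_cat_nat _ Kn)//= addrAC subrr add0r.
rewrite !split; apply: le_trans (ler_norm_sum _ _ _) _.
by apply: ler_sum_nat => i /andP[Ki _]; apply: uc; apply: leq_trans Ki.
Qed.

(** Dominated convergence for series: [K] makes the tail of [c] small, hence the tails of all [f M]
    and of [g], and then [M0] handles the finitely many remaining terms. *)
Lemma tannery (f : nat -> nat -> R) (g c S : nat -> R) :
    (forall M n, (0 < n)%N -> `|f M n| <= c n) ->
    (forall n, (0 < n)%N -> f ^~ n @ \oo --> g n) ->
    cvgn (psum c) -> (forall M, psum (f M) @ \oo --> S M) ->
  S @ \oo --> limn (psum g).
Proof.
move=> fc fg cc fS.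
have gc n : (0 < n)%N -> `|g n| <= c n.
  move=> n0; have cn : `|f M n| @[M --> \oo] --> `|g n| by apply: cvg_norm; apply: fg.
  rewrite -(cvg_lim (@Rhausdorff R) cn); apply: limr_le; first exact: cvgP cn.
  by exists 0%N => // M _ /=; apply: fc.
have cg : cvgn (psum g) by exact: psum_dom_cvg cc.
apply/cvgrPdist_lt => e e0.
have e3 : 0 < e / 3 by rewrite divr_gt0.
have /cvgrPdist_lt/(_ _ e3)[K _ HK] : psum c @ \oo --> limn (psum c) by [].
have {}HK : limn (psum c) - psum c K.+1 < e / 3.
  by apply: le_lt_trans (ler_norm _) (HK _ _) => /=.
have /cvgrPdist_lt/(_ _ e3)[M0 _ HM] :
    psum (f M) K.+1 @[M --> \oo] --> psum g K.+1.
  by apply: cvg_sum_nat => i /andP[i0 _]; apply: fg.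
exists M0 => // M /= /HM {}HM.
have t1 := psum_tail K (fc M) (fS M) cc.
have t2 := psum_tail K gc cg cc.
(* Two tails and a finite part, each bounded by [e / 3]. *)
have -> : limn (psum g) - S M = (limn (psum g) - psum g K.+1)
  + ((psum g K.+1 - psum (f M) K.+1) - (S M - psum (f M) K.+1)) by ring.
apply: le_lt_trans (ler_normD _ _) _.
apply: le_lt_trans (lerD (le_refl _) (ler_normB _ _)) _.
by move: t1 t2 HM HK; lra.
Qed.

(** Setting row [M] to 0 from index [M] on turns the truncated sum into a full series, so domination
    is required only for [n < M]. *)
Lemma tannery_psum (f : nat -> nat -> R) (g c : nat -> R) :
    (forall M n, (0 < n < M)%N -> `|f M n| <= c n) ->
    (forall n, (0 < n)%N -> 0 <= c n) ->
    (forall n, (0 < n)%N -> f ^~ n @ \oo --> g n) ->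
    cvgn (psum c) ->
  psum (f M) M @[M --> \oo] --> limn (psum g).
Proof.
move=> fc c0 fg cc; pose f' M n := if (n < M)%N then f M n else 0.
apply: (@tannery f' g c) => // [M n n0|n n0|M].
- rewrite /f'; case: ltnP => nM; first by rewrite fc ?n0.
  by rewrite normr0 c0.
- apply: (@eventually_eq_cvg (f ^~ n) _ _ n.+1) (fg n n0).
  by move=> M nM; rewrite /f' nM.
- apply: (@eventually_eq_cvg (fun=> psum (f M) M) _ _ M.+1); last exact: cvg_cst.
  move=> n /ltnW Mn; case: M Mn => [|M] Mn.
    by rewrite /psum /f' big_geq// big1.
  rewrite {2}/psum (big_cat_nat _ Mn)//= [X in _ + X]big_nat.
  rewrite [X in _ + X]big1 => [|i /andP[Mi _]].
    by rewrite addr0; apply: eq_big_nat => i /andP[_ iM]; rewrite /f' iM.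
  by rewrite /f' ltnNge Mi.
Qed.

End SeriesFromOne.

(** * Sums over half-integers, their limits and uniform bounds *)

Section HalfIntegerSums.
Variable R : realType.
Implicit Types (G : R -> R) (p q m n s k l M N : nat).

Definition half k : R := k%:R - 2^-1.

Lemma half_gt0 k : (0 < k)%N -> 0 < half k.
Proof. by rewrite /half -(ler1n R) => k1; lra. Qed.

Lemma cvg_half_square : cvgn (psum (fun k => half k ^- 2)).
Proof.
apply: nondecreasing_is_cvgn.
  by move=> a b; apply: psum_mono => i _; rewrite invr_ge0 sqr_ge0.
(* The first term is 4 = 5 - 1; afterwards [(n + 3/2)^2 >= (n + 1) (n + 2)] makes the bound
   telescope. *)
have bound n : psum (fun k => half k ^- 2) n.+2 <= 5 - n.+1%:R^-1.
  elim: n => [|n IH].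
    rewrite /psum big_nat1 /half.
    have -> : (1%:R - 2^-1 : R) = 2^-1 by field.
    by rewrite exprVn invrK; lra.
  rewrite /psum big_nat_recr//=; apply: le_trans (lerD IH (le_refl _)) _.
  have n0 : 0 <= n%:R :> R by [].
  have -> : half n.+2 = n%:R + 3 / 2.
    by rewrite /half -addn2 natrD; field.
  rewrite -[n.+2]addn2 -[n.+1]addn1 !natrD; move: (n%:R : R) n0 => x x0.
  have -> : 5 - (x + 2)^-1 = 5 - (x + 1)^-1 + ((x + 1) * (x + 2))^-1.
    by field; rewrite !gt_eqF//; lra.
  rewrite lerD2l lef_pV2 ?posrE; [nra| nra |].
  by rewrite mulr_gt0//; lra.
exists 5 => _ [n _ <-].
apply: (@le_trans _ _ (psum (fun k => half k ^- 2) n.+2)).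
  by apply: psum_mono; [move=> i _; rewrite invr_ge0 sqr_ge0 | lia].
by apply: le_trans (bound n) _; rewrite gerBl invr_ge0.
Qed.

Lemma half_pow_ge0 s k : (0 < k)%N -> 0 <= half k ^- s.
Proof. by move=> k0; rewrite invr_ge0 exprn_ge0// ltW// half_gt0. Qed.

Lemma nat_pow_ge0 s k : 0 <= (k%:R : R) ^- s.
Proof. by rewrite invr_ge0 exprn_ge0. Qed.

Lemma is_cvg_half_pow s : (1 < s)%N -> cvgn (psum (fun k => half k ^- s)).
Proof.
move=> s1; apply: (@psum_nneg_cvg _ _ (fun k => 2 ^+ s * half k ^- 2)) => [k k0|].
  rewrite half_pow_ge0//=; have h0 := half_gt0 k0.
  have k1 : 1 <= k%:R :> R by rewrite ler1n.
  (* Rescaling gives a base at most 1, whose powers decrease with the exponent. *)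
  have -> : half k ^- s = 2 ^+ s * ((2 * half k)^-1) ^+ s.
    by rewrite exprVn exprMn invfM mulrA divff ?mul1r// expf_neq0.
  rewrite ler_pM2l ?exprn_gt0//.
  have y0 : 0 < (2 * half k)^-1 by rewrite invr_gt0 mulr_gt0.
  have y1 : (2 * half k)^-1 <= 1.
    by rewrite invf_le1 ?mulr_gt0// /half; lra.
  apply: le_trans (ler_wiXn2l (ltW y0) y1 s1) _.
  rewrite exprVn lef_pV2 ?posrE ?exprn_gt0 ?mulr_gt0//.
  by rewrite lerXn2r ?nnegrE; lra.
rewrite (funext (psumZ (2 ^+ s) (fun k => half k ^- 2))).
by apply: is_cvgMl_tmp; exact: cvg_half_square.
Qed.

Lemma cvg_ttilde s : (1 < s)%N ->
  psum (fun k => half k ^- s) @ \oo --> ttilde R s.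
Proof. exact: is_cvg_half_pow. Qed.

Lemma is_cvg_nat_pow s : (1 < s)%N -> cvgn (psum (fun k => (k%:R : R) ^- s)).
Proof.
move=> s1; apply: psum_nneg_cvg (is_cvg_half_pow s1) => k k0.
have h0 := half_gt0 k0.
have k1 : 1 <= k%:R :> R by rewrite ler1n.
rewrite nat_pow_ge0/= lef_pV2 ?posrE ?exprn_gt0//; last lra.
by rewrite lerXn2r ?nnegrE /half; lra.
Qed.

Lemma cvg_zeta s : (1 < s)%N ->
  psum (fun k => (k%:R : R) ^- s) @ \oo --> zeta R s.
Proof. exact: is_cvg_nat_pow. Qed.

Lemma psum_half_le s n : (1 < s)%N -> psum (fun k => half k ^- s) n <= ttilde R s.
Proof.
move=> s1; apply: psum_le_lim; last exact: is_cvg_half_pow.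
by move=> i; apply: half_pow_ge0.
Qed.

Lemma psum_nat_le s n : (1 < s)%N ->
  psum (fun k => (k%:R : R) ^- s) n <= zeta R s.
Proof.
move=> s1; apply: psum_le_lim; last exact: is_cvg_nat_pow.
by move=> i _; apply: nat_pow_ge0.
Qed.

Lemma ttilde_ge0 s : (1 < s)%N -> 0 <= ttilde R s.
Proof. by move=> s1; have := psum_half_le 0 s1; rewrite /psum big_geq. Qed.

Lemma zeta_ge0 s : (1 < s)%N -> 0 <= zeta R s.
Proof. by move=> s1; have := psum_nat_le 0 s1; rewrite /psum big_geq. Qed.

(** Translation by [n] preserves the half-integers: the index [k <= n] goes to [- half (n + 1 - k)]
    and [k > n] to [half (k - n)]. *)
Lemma sum_half_sub G n M : (n < M)%N ->
  \sum_(1 <= k < M) G (half k - n%:R)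
  = psum (fun k => G (- half k)) n.+1 + psum (fun k => G (half k)) (M - n).
Proof.
move=> nM; rewrite (big_cat_nat (n:=n.+1))//=; congr (_ + _).
  rewrite big_nat_rev/=; apply: eq_big_nat => k /andP[k0 kn]; congr G.
  rewrite /half add1n !subSS natrB; last by lia.
  by rewrite -[n.+1]addn1 natrD; field.
rewrite -{1}[n.+1]add1n big_addn; apply: eq_bigr => k _; congr G.
by rewrite /half natrD; ring.
Qed.

Lemma sum_half_add G n M : (0 < M)%N ->
  \sum_(1 <= k < M) G (half k + n%:R)
  = psum (fun k => G (half k)) (M + n) - psum (fun k => G (half k)) n.+1.
Proof.
move=> M0; rewrite /psum (big_cat_nat (n:=n.+1) (p:=(M + n)%N))//=; last lia.
rewrite addrAC subrr add0r -[n.+1]add1n big_addn addnK.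
by apply: eq_bigr => k _; congr G; rewrite /half natrD; ring.
Qed.

(** Differences of distinct half-integers are nonzero integers; this is the source of the zeta
    values and of the harmonic numbers at [l - 1]. *)
Lemma sum_half_offdiag G l M : (0 < l < M)%N ->
  \sum_(1 <= k < M | k != l) G (half k - half l)
  = psum (fun k => G (- k%:R)) l + psum (fun k => G k%:R) (M - l).
Proof.
move=> /andP[l0 lM]; rewrite (big_cat_nat (n:=l)) ?(ltnW lM)//=.
rewrite [X in _ + X]big_ltn_cond// eqxx/=; congr (_ + _).
  rewrite big_nat_rev/= add1n big_nat_cond [in RHS]/psum big_nat.
  apply: eq_big => k; first by case: (boolP (1 <= k < l)%N) => //=; lia.
  move=> /andP[/andP[k0 kl] _]; congr G.
  by rewrite /half subSS natrB ?(ltnW kl)//; ring.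
rewrite -{1}[l.+1]add1n big_addn big_nat_cond [in RHS]/psum big_nat.
apply: eq_big => k; first by case: (boolP (1 <= k < _)%N) => //=; lia.
by move=> _; congr G; rewrite /half natrD; ring.
Qed.

Definition half_pole_sum p M (s : R) : R := \sum_(1 <= k < M) (half k - s) ^- p.

Lemma psum_halfN p n : psum (fun k => (- half k) ^- p) n.+1
  = (-1) ^+ p * half_harmonic_sum R p n.
Proof. by rewrite -psumZ; apply: eq_bigr => k _; rewrite invrXN. Qed.

Lemma cvg_half_pole_sum p n : (1 < p)%N ->
  half_pole_sum p M n%:R @[M --> \oo]
    --> ttilde R p + (-1) ^+ p * half_harmonic_sum R p n.
Proof.
move=> p1; rewrite addrC.
apply: (@eventually_eq_cvg _ (fun M => (-1) ^+ p * half_harmonic_sum R p n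
   + psum (fun k => half k ^- p) (M - n)) _ _ n.+1) => [M nM|].
  by rewrite /half_pole_sum (sum_half_sub (fun x => x ^- p)) ?psum_halfN.
apply: cvgD; first exact: cvg_cst.
by rewrite cvg_centern; exact: cvg_ttilde.
Qed.

Lemma cvg_half_pole_sumN p n : (1 < p)%N ->
  half_pole_sum p M (- n%:R) @[M --> \oo]
    --> ttilde R p - half_harmonic_sum R p n.
Proof.
move=> p1.
apply: (@eventually_eq_cvg _ (fun M => psum (fun k => half k ^- p) (M + n)
   - half_harmonic_sum R p n) _ _ 1) => [M M0|].
  rewrite /half_pole_sum; under eq_bigr do rewrite opprK.
  by rewrite (sum_half_add (fun x => x ^- p)).
apply: cvgB; last exact: cvg_cst.
by rewrite cvg_shiftn; exact: cvg_ttilde.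
Qed.

Lemma normr_invX (x : R) p : `|x ^- p| = `|x| ^- p.
Proof. by rewrite normfV normrX. Qed.

(** The bound is uniform in [M] and [n], as domination requires: the negative and the positive
    translated points each contribute at most [ttilde R p]. *)
Lemma half_pole_sum_le p M n : (1 < p)%N ->
  `|half_pole_sum p M n%:R| <= 2 * ttilde R p.
Proof.
move=> p1; apply: le_trans (ler_norm_sum _ _ _) _.
(* The range is enlarged beyond [n] so that [sum_half_sub] applies for every [M]. *)
apply: (@le_trans _ _ (psum (fun k => `|half k - n%:R| ^- p) (M + n.+1))).
  under eq_bigr do rewrite normr_invX.
  apply: (@psum_mono _ (fun k => `|half k - n%:R| ^- p)); last by lia.
  by move=> i _; rewrite invr_ge0 exprn_ge0.
rewrite /psum (sum_half_sub (fun x => `|x| ^- p)); last by lia.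
have E N : psum (fun k => `|half k| ^- p) N <= ttilde R p.
  apply: le_trans (psum_half_le N p1); apply: psum_le => i i0.
  by rewrite gtr0_norm ?half_gt0.
rewrite mulrC mulr_natr mulr2n lerD//.
by apply: le_trans (E n.+1); apply: psum_le => i i0; rewrite normrN.
Qed.

Lemma half_pole_sumN_le p M n : (1 < p)%N ->
  `|half_pole_sum p M (- n%:R)| <= 2 * ttilde R p.
Proof.
move=> p1; have t0 := ttilde_ge0 p1.
have [->|M0] := posnP M.
  by rewrite /half_pole_sum big_geq// normr0 mulr_ge0.
rewrite /half_pole_sum; under eq_bigr do rewrite opprK.
rewrite (sum_half_add (fun x => x ^- p))//.
have := psum_half_le (M + n) p1; have := psum_half_le n.+1 p1.
have h0 i : (0 < i)%N -> 0 <= half i ^- p by exact: half_pow_ge0.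
have := psum_mono (u:=fun k => half k ^- p) (m:=0) (n:=n.+1) h0 isT.
have := psum_mono (u:=fun k => half k ^- p) (m:=0) (n:=M + n) h0 isT.
rewrite {1 3}/psum !(big_geq (m:=1) (n:=0))//.
by rewrite ler_norml; lra.
Qed.

Definition offdiag_sum m M l : R :=
  \sum_(1 <= k < M | k != l) (half k - half l) ^- m.

Lemma cvg_offdiag_sum m l : (1 < m)%N -> (0 < l)%N ->
  offdiag_sum m M l @[M --> \oo]
    --> zeta R m + (-1) ^+ m * harmonic_sum R m (l - 1).
Proof.
move=> m1 l0; rewrite addrC.
apply: (@eventually_eq_cvg _ (fun M => (-1) ^+ m * harmonic_sum R m (l - 1)
   + psum (fun k => (k%:R : R) ^- m) (M - l)) _ _ l.+1) => [M lM|].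
  rewrite /offdiag_sum (sum_half_offdiag (fun x => x ^- m)) ?l0//.
  congr (_ + _); rewrite /harmonic_sum subn1 prednK// mulr_sumr.
  by apply: eq_bigr => k _; rewrite invrXN.
apply: cvgD; first exact: cvg_cst.
by rewrite cvg_centern; exact: cvg_zeta.
Qed.

Lemma offdiag_sum_le m M l : (1 < m)%N -> (0 < l < M)%N ->
  `|offdiag_sum m M l| <= 2 * zeta R m.
Proof.
move=> m1 lM; apply: le_trans (ler_norm_sum _ _ _) _.
under eq_bigr do rewrite normr_invX.
rewrite (sum_half_offdiag (fun x => `|x| ^- m))//.
rewrite mulrC mulr_natr mulr2n.
apply: le_trans (lerD (psum_nat_le l m1) (psum_nat_le (M - l) m1)).
apply: lerD; apply: psum_le => i _; rewrite ?normrN ger0_norm//.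
Qed.

(** The effect of pairing opposite signs: even orders are doubled and odd ones vanish, in particular
    order 1, where [zeta] and [ttilde] carry no meaning. *)
Definition even_part (u : nat -> R) i : R := (1 + (-1) ^+ i) * u i.

Lemma cvg_power_sum i : (0 < i)%N ->
  power_sum R N i @[N --> \oo] --> even_part (zeta R) i.
Proof.
move=> i0; have -> : power_sum R ^~ i
    = (fun N => (1 + (-1) ^+ i) * psum (fun k => k%:R ^- i) N).
  apply/funext => N; rewrite -psumZ; apply: eq_bigr => k _.
  by rewrite invrXN; ring.
(* At order 1 the terms at [n] and [- n] cancel exactly, so no convergence of the harmonic series is
   involved. *)
have [i1|] := ltnP 1 i; first by apply: cvgMl_tmp; exact: cvg_zeta.
case: i i0 => [|[]]// _ _; rewrite /even_part expr1 subrr mul0r.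
by under eq_fun do rewrite mul0r; exact: cvg_cst.
Qed.

(** The points [half k - n] are half-integers of both signs; a window symmetric in [n] is off-center
    for them, whence the bounds [N + k] and [N - k.-1]. *)
Lemma lattice_sum_half N k r : (0 < k < N)%N ->
  lattice_sum N (half k) r = psum (fun j => half j ^- r) (N + k)
    + (-1) ^+ r * psum (fun j => half j ^- r) (N - k.-1).
Proof.
move=> /andP[k0 kN]; rewrite /lattice_sum /sum_pm big_split/=.
have -> : \sum_(1 <= n < N) (half k - n%:R) ^- r
   = psum (fun j => half j ^- r) k
     + (-1) ^+ r * psum (fun j => half j ^- r) (N - k.-1).
  (* Reflection: [half k - n = - (half n - k.-1)]. *)
  have := sum_half_sub (fun x => (- x) ^- r) (n:=k.-1) (M:=N).
  rewrite (leq_ltn_trans (leq_pred k) kN) prednK// => /(_ isT) E.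
  transitivity (\sum_(1 <= n < N) (- (half n - k.-1%:R)) ^- r).
    apply: eq_bigr => n _; congr (_ ^- _).
    by rewrite /half -[in LHS](prednK k0) -[k.-1.+1]addn1 natrD; field.
  rewrite E -psumZ; congr (_ + _).
    by apply: eq_bigr => j _; rewrite opprK.
  by apply: eq_bigr => j _; rewrite invrXN.
have -> : \sum_(1 <= n < N) (half k - - n%:R) ^- r
   = psum (fun j => half j ^- r) (N + k) - psum (fun j => half j ^- r) k.+1.
  rewrite -(sum_half_add (fun x => x ^- r)) ?(leq_ltn_trans _ kN)//.
  by apply: eq_bigr => n _; congr (_ ^- _); rewrite /half; ring.
have -> : psum (fun j => half j ^- r) k.+1
    = psum (fun j => half j ^- r) k + half k ^- r by rewrite /psum big_nat_recr.
by ring.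
Qed.

Lemma cvg_half_inv0 : (half k)^-1 @[k --> \oo] --> (0 : R).
Proof.
rewrite -(cvg_shiftn 2).
have h1 : harmonic n @[n --> \oo] --> (0 : R) by exact: cvg_harmonic.
apply: (squeeze_cvgr _ (cvg_cst 0) h1); exists 0%N => // n _ /=.
have h0 : 0 < half (n + 2) by rewrite half_gt0// addn2.
rewrite invr_ge0 (ltW h0)/= lef_pV2 ?posrE// /half natrD -natr1.
by lra.
Qed.

Lemma cvg_lattice_sum k r : (0 < k)%N -> (0 < r)%N ->
  lattice_sum N (half k) r @[N --> \oo] --> even_part (ttilde R) r.
Proof.
move=> k0 r0; apply: (@eventually_eq_cvg _ (fun N =>
  psum (fun j => half j ^- r) (N + k)
    + (-1) ^+ r * psum (fun j => half j ^- r) (N - k.-1)) _ _ k.+1) => [N kN|].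
  by rewrite lattice_sum_half ?k0.
have [r1|] := ltnP 1 r.
  rewrite /even_part mulrDl mul1r; apply: cvgD.
    by rewrite (cvg_shiftn k (psum (fun j => half j ^- r))); exact: cvg_ttilde.
  apply: cvgMl_tmp.
  by rewrite (cvg_centern k.-1 (psum (fun j => half j ^- r))); exact: cvg_ttilde.
case: r r0 => [|[]]// _ _; rewrite /even_part expr1 subrr mul0r.
(* the two partial sums differ by [k + k.-1] terms of index at least [N - k.-1] *)
apply: (@eventually_eq_cvg _ (fun N =>
  \sum_(i < k + k.-1) (half (i + (N - k.-1)))^-1) _ _ k.+1) => [N kN|].
  rewrite mulN1r /psum (big_cat_nat (n:=(N - k.-1)%N) (p:=(N + k)%N))//=; try lia.
  rewrite addrAC subrr add0r -[in RHS](add0n (N - k.-1)%N) big_addn.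
  rewrite (_ : N + k - (N - k.-1) = k + k.-1)%N; last by lia.
  by rewrite big_mkord.
have cE : \sum_(i < k + k.-1) (half (i + (N - k.-1)))^-1 @[N --> \oo]
    --> \sum_(i < k + k.-1) (0 : R).
  apply: (@cvg_sum_ord _ _ (fun N i => (half (i + (N - k.-1)))^-1)) => i.
  rewrite (cvg_centern k.-1 (fun n => (half (i + n))^-1)).
  have c0 := cvg_half_inv0; rewrite -(cvg_shiftn i) in c0.
  apply: (@eventually_eq_cvg _ _ _ _ 0%N _ c0) => n _ /=.
  by rewrite addnC.
by rewrite big1_eq in cE.
Qed.

Lemma half_off_lattice N k : off_lattice N (half k).
Proof.
have nat_ne m n : half m != n%:R.
  (* After doubling, an even natural number would equal an odd one. *)
  rewrite /half subr_eq; apply/eqP => /(congr1 ( *%R 2)).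
  rewrite mulrDr divff// -!natrM natr1 => /eqP; rewrite eqr_nat; lia.
split; first exact: (nat_ne k 0%N).
move=> n n0; split=> //; rewrite -subr_eq0 opprK.
have -> : half k + n%:R = half (k + n) by rewrite /half natrD; ring.
exact: (nat_ne _ 0%N).
Qed.

Lemma half_inj : injective half.
Proof. by move=> k l /addIr/eqP; rewrite eqr_nat => /eqP. Qed.

End HalfIntegerSums.

(** * Summation over all pairs of poles and the two limits *)

Section ResidueIdentity.
Variable R : realType.
Implicit Types (p q m n s k l M N : nat) (Z : nat -> R) (E : nat -> nat -> R).
Local Notation half := (half R).

(** Contribution of the pole [half k], of order [p], over all pairs with a different second pole;
    the sum over the second pole has become [offdiag_sum]. *)
Definition cross_sum p p' q M E : R :=
  \sum_(1 <= k < M) \sum_(i < p) (-1) ^+ i * 'C((p' + i).-1, i)%:R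
     * offdiag_sum R (p' + i) M k * pole_part (half k) (p - i) q (E k).

(** [Z] and [E] are parameters so that the same expression covers the power and lattice sums cut at
    [N] and their limits. *)
Definition residue_sum p1 p2 q M Z E : R :=
  \sum_(1 <= k < M) \sum_(1 <= l < M)
     res0 Z q (conv (taylor (half k) p1) (taylor (half l) p2))
  + \sum_(1 <= k < M) pole_part (half k) (p1 + p2) q (E k)
  + cross_sum p1 p2 q M E + cross_sum p2 p1 q M E.

Lemma sum_diag_split M (X : nat -> nat -> R) :
  \sum_(1 <= k < M) \sum_(1 <= l < M) X k l
  = \sum_(1 <= k < M) X k k
    + \sum_(1 <= k < M) \sum_(1 <= l < M | l != k) X k l.
Proof.
rewrite -big_split; apply: eq_big_nat => k kM /=.
by rewrite (bigD1_seq k)/= ?mem_index_iota ?iota_uniq.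
Qed.

Lemma exchange_offdiag M (X : nat -> nat -> R) :
  \sum_(1 <= k < M) \sum_(1 <= l < M | l != k) X k l
  = \sum_(1 <= l < M) \sum_(1 <= k < M | k != l) X k l.
Proof.
under eq_bigr do rewrite big_mkcond; rewrite exchange_big/=.
by apply: eq_bigr => l _; rewrite -big_mkcond; apply: eq_bigl => k; rewrite eq_sym.
Qed.

Lemma sum_pole_sum N M p1 p2 q :
  \sum_(1 <= k < M) \sum_(1 <= l < M) pole_sum N (half k) (half l) p1 p2 q
  = sum_pm N (fun s : R => half_pole_sum p1 M s * half_pole_sum p2 M s * s ^- q).
Proof.
under eq_bigr do rewrite exchange_big/=.
rewrite exchange_big/=; apply: eq_bigr => n _.
rewrite /half_pole_sum !big_distrlr/= !mulr_suml -big_split; apply: eq_bigr => k _.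
by rewrite !mulr_suml -big_split.
Qed.

(** Expand the product over pairs of poles and use [pole_sum_diag] for equal and [pole_sum_offdiag]
    for distinct ones; swapping the roles of [k] and [l] gives the second cross sum. *)
Lemma sum_pm_half_pole_sum N M p1 p2 q : (0 < p1)%N ->
  sum_pm N (fun s : R => half_pole_sum p1 M s * half_pole_sum p2 M s * s ^- q)
  = residue_sum p1 p2 q M (power_sum R N) (fun k => lattice_sum N (half k)).
Proof.
move=> p10; rewrite -sum_pole_sum /residue_sum sum_diag_split.
rewrite [X in _ = X + _ + _ + _]sum_diag_split.
pose W k l := res0 (power_sum R N) q (conv (taylor (half k) p1) (taylor (half l) p2)).
pose P k := pole_part (half k) ^~ q ^~ (lattice_sum N (half k)).
pose C k l := \sum_(i < p1) (-1) ^+ i * 'C((p2 + i).-1, i)%:R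
   * (half l - half k) ^- (p2 + i) * P k (p1 - i)%N.
pose C' k l := \sum_(i < p2) (-1) ^+ i * 'C((p1 + i).-1, i)%:R
   * (half k - half l) ^- (p1 + i) * P l (p2 - i)%N.
have HL k := @half_off_lattice R N k.
have -> : \sum_(1 <= k < M) pole_sum N (half k) (half k) p1 p2 q
    = \sum_(1 <= k < M) W k k + \sum_(1 <= k < M) P k (p1 + p2)%N.
  by rewrite -big_split; apply: eq_bigr => k _; rewrite pole_sum_diag.
have -> : \sum_(1 <= k < M) \sum_(1 <= l < M | l != k)
      pole_sum N (half k) (half l) p1 p2 q
    = \sum_(1 <= k < M) \sum_(1 <= l < M | l != k) W k l
      + \sum_(1 <= k < M) \sum_(1 <= l < M | l != k) C k l
      + \sum_(1 <= k < M) \sum_(1 <= l < M | l != k) C' k l.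
  rewrite -!big_split; apply: eq_bigr => k _; rewrite -!big_split.
  apply: eq_bigr => l lk; rewrite pole_sum_offdiag//.
  by apply: contraNneq lk => /half_inj ->.
have -> : \sum_(1 <= k < M) \sum_(1 <= l < M | l != k) C k l
    = cross_sum p1 p2 q M (fun k => lattice_sum N (half k)).
  apply: eq_bigr => k _; rewrite exchange_big; apply: eq_bigr => i _ /=.
  by rewrite -mulr_suml -mulr_sumr.
have -> : \sum_(1 <= k < M) \sum_(1 <= l < M | l != k) C' k l
    = cross_sum p2 p1 q M (fun k => lattice_sum N (half k)).
  rewrite exchange_offdiag.
  apply: eq_bigr => k _; rewrite exchange_big; apply: eq_bigr => i _ /=.
  by rewrite -mulr_suml -mulr_sumr.
by rewrite /W /P; ring.
Qed.

Lemma cvg_pole_part (c : R) p q (U : nat -> nat -> R) (V : nat -> R) :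
  (forall r, (0 < r)%N -> U ^~ r @ \oo --> V r) ->
  pole_part c p q (U N) @[N --> \oo] --> pole_part c p q V.
Proof.
move=> UV; apply: cvg_sum_ord => i; apply: cvgMl_tmp; apply: UV.
by rewrite subn_gt0.
Qed.

Lemma cvg_residue_sum p1 p2 q M :
  residue_sum p1 p2 q M (power_sum R N) (fun k => lattice_sum N (half k))
    @[N --> \oo]
  --> residue_sum p1 p2 q M (even_part (zeta R)) (fun=> even_part (ttilde R)).
Proof.
have cP k p : (1 <= k < M)%N ->
    pole_part (half k) p q (lattice_sum N (half k)) @[N --> \oo]
    --> pole_part (half k) p q (even_part (ttilde R)).
  by move=> /andP[k0 _]; apply: cvg_pole_part => r r0; apply: cvg_lattice_sum.
have cC p p' : cross_sum p p' q M (fun k => lattice_sum N (half k)) @[N --> \oo]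
    --> cross_sum p p' q M (fun=> even_part (ttilde R)).
  apply: cvg_sum_nat => k kM; apply: cvg_sum_ord => i.
  by apply: cvgMl_tmp; apply: cP.
apply: cvgD; last exact: cC.
apply: cvgD; last exact: cC.
apply: cvgD; last by apply: cvg_sum_nat => k kM; apply: cP.
apply: cvg_sum_nat => k _; apply: cvg_sum_nat => l _.
apply: cvgD; first exact: cvg_cst.
apply: cvg_sum_ord => j; apply: cvgMl_tmp; apply: cvg_power_sum.
by rewrite subn_gt0.
Qed.

(** The coefficient of [s ^ j] in the expansion at 0 of the full sum [F p (s)]. *)
Definition theta p j : R := 'C((p + j).-1, j)%:R * ttilde R (p + j).

Definition cross_limit m s : R :=
  zeta R m * ttilde R s
  + (-1) ^+ m * \sum_(1 <= n <oo) (harmonic_sum R m (n - 1) / half n ^+ s).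

Lemma psum_harmonic_le m n : (1 < m)%N ->
  0 <= harmonic_sum R m (n - 1) <= zeta R m.
Proof.
move=> m1; rewrite psum_nat_le// andbT.
by apply: sumr_ge0 => i _; exact: nat_pow_ge0.
Qed.

Lemma half_harmonic_le p n : (1 < p)%N ->
  0 <= half_harmonic_sum R p n <= ttilde R p.
Proof.
move=> p1; rewrite psum_half_le// andbT /half_harmonic_sum big_nat.
by apply: sumr_ge0 => i /andP[i0 _]; exact: half_pow_ge0.
Qed.

(** Both the summand and the range depend on [M], so [tannery_psum] is used, with the uniform bound
    on [offdiag_sum]. *)
Lemma cvg_offdiag_psum m s : (1 < m)%N -> (1 < s)%N ->
  psum (fun k => offdiag_sum R m M k * half k ^- s) M @[M --> \oo]
  --> cross_limit m s.
Proof.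
move=> m1 s1; pose g n :=
  (zeta R m + (-1) ^+ m * harmonic_sum R m (n - 1)) * half n ^- s.
have cB (b : R) : cvgn (psum (fun k => b * half k ^- s)).
  rewrite (funext (psumZ b (fun k => half k ^- s))).
  by apply: is_cvgMl_tmp; exact: is_cvg_half_pow.
have z0 := zeta_ge0 R m1.
have -> : cross_limit m s = limn (psum g).
  pose u n := harmonic_sum R m (n - 1) / half n ^+ s.
  have cu : psum u @ \oo --> limn (psum u).
    apply: (psum_dom_cvg _ (cB (zeta R m))) => k k0.
    have /andP[H0 H1] := psum_harmonic_le k m1.
    rewrite normrM ger0_norm// ger0_norm ?half_pow_ge0//.
    by rewrite ler_wpM2r ?half_pow_ge0.
  apply/esym/cvg_lim => //.
  have -> : psum g = (fun n => zeta R m * psum (fun k => half k ^- s) n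
      + (-1) ^+ m * psum u n).
    apply/funext => n; rewrite -!psumZ -psumD; apply: eq_bigr => k _.
    by rewrite /g /u; ring.
  apply: cvgD; apply: cvgMl_tmp => //; exact: cvg_ttilde.
apply: (tannery_psum (c:=fun k => 2 * zeta R m * half k ^- s)) => //.
- move=> M n nM; have /andP[n0 _] := nM.
  rewrite normrM [X in _ * X]ger0_norm ?half_pow_ge0//.
  by rewrite ler_wpM2r ?half_pow_ge0// offdiag_sum_le.
- by move=> n n0; rewrite mulr_ge0 ?half_pow_ge0// mulr_ge0.
- by move=> n n0; apply: cvgMr_tmp; exact: cvg_offdiag_sum.
Qed.

Definition cross_value p p' q : R :=
  \sum_(i < p) (-1) ^+ i * 'C((p' + i).-1, i)%:R
   * \sum_(j < p - i) 'C((q + j).-1, j)%:R * even_part (ttilde R) (p - i - j)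
     * cross_limit (p' + i) (q + j).

Lemma cvg_cross_sum p p' q : (1 < p')%N -> (1 < q)%N ->
  cross_sum p p' q M (fun=> even_part (ttilde R)) @[M --> \oo]
  --> cross_value p p' q.
Proof.
(* Expanding [pole_part] and moving the sum over [k] innermost leaves finite sums, of length
   independent of [M], of the series just treated. *)
move=> p'1 q1; have -> : (fun M => cross_sum p p' q M (fun=> even_part (ttilde R)))
   = (fun M => \sum_(i < p) (-1) ^+ i * 'C((p' + i).-1, i)%:R
   * \sum_(j < p - i) 'C((q + j).-1, j)%:R * even_part (ttilde R) (p - i - j)
     * psum (fun k => offdiag_sum R (p' + i) M k * half k ^- (q + j)) M).
  apply/funext => M; rewrite /cross_sum exchange_big/=; apply: eq_bigr => i _.
  rewrite mulr_sumr; under [RHS]eq_bigr do rewrite /psum mulr_sumr mulr_sumr.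
  rewrite exchange_big/=; apply: eq_bigr => k _; rewrite mulr_sumr.
  by apply: eq_bigr => j _; ring.
apply: cvg_sum_ord => i; apply: cvgMl_tmp; apply: cvg_sum_ord => j.
by apply: cvgMl_tmp; apply: cvg_offdiag_psum;
  rewrite (leq_trans _ (leq_addr _ _)).
Qed.

(** [res0] is linear and [conv] bilinear, so the double sum factors. *)
Lemma sum_res0 Z q M (u v : nat -> nat -> R) :
  \sum_(1 <= k < M) \sum_(1 <= l < M) res0 Z q (conv (u k) (v l))
  = res0 Z q (conv (fun i => \sum_(1 <= k < M) u k i)
                   (fun i => \sum_(1 <= l < M) v l i)).
Proof.
have cE j : \sum_(1 <= k < M) \sum_(1 <= l < M) conv (u k) (v l) j
    = conv (fun i => \sum_(1 <= k < M) u k i)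
           (fun i => \sum_(1 <= l < M) v l i) j.
  rewrite /conv; under eq_bigr do rewrite exchange_big/=.
  by rewrite exchange_big/=; apply: eq_bigr => i _; rewrite big_distrlr.
transitivity (\sum_(1 <= k < M) (- \sum_(1 <= l < M) conv (u k) (v l) q
    + \sum_(j < q) (\sum_(1 <= l < M) conv (u k) (v l) j) * Z (q - j)%N)).
  apply: eq_bigr => k _; rewrite /res0 big_split/= sumrN; congr (_ + _).
  by rewrite exchange_big/=; apply: eq_bigr => j _; rewrite mulr_suml.
rewrite big_split/= sumrN cE; congr (_ + _).
by rewrite exchange_big/=; apply: eq_bigr => j _; rewrite -cE mulr_suml.
Qed.

Definition residue_value p1 p2 q : R :=
  res0 (even_part (zeta R)) q (conv (theta p1) (theta p2))
  + \sum_(i < p1 + p2) 'C((q + i).-1, i)%:R * ttilde R (q + i)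
      * even_part (ttilde R) (p1 + p2 - i)
  + cross_value p1 p2 q + cross_value p2 p1 q.

Lemma cvg_residue_sum_value p1 p2 q : (1 < p1)%N -> (1 < p2)%N -> (1 < q)%N ->
  residue_sum p1 p2 q M (even_part (zeta R)) (fun=> even_part (ttilde R))
    @[M --> \oo] --> residue_value p1 p2 q.
Proof.
move=> p11 p21 q1.
have ct p j : (1 < p)%N ->
    \sum_(1 <= k < M) taylor (half k) p j @[M --> \oo] --> theta p j.
  move=> p_gt1; under eq_fun do rewrite -mulr_sumr; apply: cvgMl_tmp.
  by apply: cvg_ttilde; rewrite (leq_trans _ (leq_addr _ _)).
have cc j : conv (fun i => \sum_(1 <= k < M) taylor (half k) p1 i)
             (fun i => \sum_(1 <= l < M) taylor (half l) p2 i) j @[M --> \oo]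
    --> conv (theta p1) (theta p2) j.
  by apply: cvg_sum_ord => i; apply: cvgM; exact: ct.
apply: cvgD; last exact: cvg_cross_sum.
apply: cvgD; last exact: cvg_cross_sum.
apply: cvgD.
  under eq_fun do rewrite sum_res0.
  apply: cvgD; first by apply: cvgN; exact: cc.
  by apply: cvg_sum_ord => j; apply: cvgMr_tmp; exact: cc.
under eq_fun do rewrite exchange_big/=.
apply: cvg_sum_ord => i.
under eq_fun do rewrite -mulr_suml -mulr_sumr.
apply: cvgMr_tmp; apply: cvgMl_tmp.
by apply: cvg_ttilde; rewrite (leq_trans _ (leq_addr _ _)).
Qed.

(** The limit in [M] of [residue_sum] is computed twice: as a series over nonzero integers, by
    Tannery, which gives the Euler sums, and pole by pole. *)
Lemma Shat_residue p1 p2 q : (1 < p1)%N -> (1 < p2)%N -> (1 < q)%N ->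
  (1 + (-1) ^+ q) * ttilde R p1 * ttilde R p2 * zeta R q
  + ((-1) ^+ p2 - (-1) ^+ q) * ttilde R p1 * Shat R p2 q
  + ((-1) ^+ p1 - (-1) ^+ q) * ttilde R p2 * Shat R p1 q
  + ((-1) ^+ (p1 + p2) + (-1) ^+ q) * Shat2 R p1 p2 q
  = residue_value p1 p2 q.
Proof.
move=> p11 p21 q1.
pose H p n := half_harmonic_sum R p n.
pose f M n := half_pole_sum p1 M n%:R * half_pole_sum p2 M n%:R * (n%:R : R) ^- q
  + half_pole_sum p1 M (- n%:R) * half_pole_sum p2 M (- n%:R) * (- n%:R : R) ^- q.
pose g n := (ttilde R p1 + (-1) ^+ p1 * H p1 n)
    * (ttilde R p2 + (-1) ^+ p2 * H p2 n) * (n%:R : R) ^- q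
  + (ttilde R p1 - H p1 n) * (ttilde R p2 - H p2 n) * (- n%:R : R) ^- q.
have cB (b : R) : cvgn (psum (fun k => b * (k%:R : R) ^- q)).
  rewrite (funext (psumZ b (fun k => (k%:R : R) ^- q))).
  by apply: is_cvgMl_tmp; exact: is_cvg_nat_pow.
have t1 := ttilde_ge0 R p11; have t2 := ttilde_ge0 R p21.
have c1 p (u := fun n => H p n / n%:R ^+ q) : (1 < p)%N ->
    psum u @ \oo --> Shat R p q.
  move=> p_gt1; apply: (psum_dom_cvg _ (cB (ttilde R p))) => n _.
  have /andP[h0 h1] := half_harmonic_le n p_gt1.
  rewrite normrM ger0_norm// ger0_norm ?nat_pow_ge0//.
  by rewrite ler_wpM2r ?nat_pow_ge0.
have c2 (u := fun n => H p1 n * H p2 n / n%:R ^+ q) : psum u @ \oo --> Shat2 R p1 p2 q.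
  apply: (psum_dom_cvg _ (cB (ttilde R p1 * ttilde R p2))) => n _.
  have /andP[h0 h1] := half_harmonic_le n p11.
  have /andP[h0' h1'] := half_harmonic_le n p21.
  rewrite normrM ger0_norm ?mulr_ge0// ger0_norm ?nat_pow_ge0//.
  by rewrite ler_wpM2r ?nat_pow_ge0// ler_pM.
(* For fixed [M], [psum (f M) N] is the symmetric partial sum that the residue identity evaluates
   exactly for each [N]. *)
have fS M : psum (f M) @ \oo -->
    residue_sum p1 p2 q M (even_part (zeta R)) (fun=> even_part (ttilde R)).
  have := @cvg_residue_sum p1 p2 q M.
  by under eq_fun do rewrite -sum_pm_half_pole_sum ?(ltnW p11)//.
have fg : residue_sum p1 p2 q M (even_part (zeta R)) (fun=> even_part (ttilde R))
    @[M --> \oo] --> limn (psum g).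
  (* Each half-pole sum is at most twice its [ttilde]; the outer 2 counts the signs of [n]. *)
  apply: (tannery (f:=f)
    (c:=fun n => 2 * (2 * ttilde R p1 * (2 * ttilde R p2)) * (n%:R : R) ^- q)) => //.
    move=> M n n0; rewrite [X in X * _]mulrC mulr_natr mulr2n mulrDl.
    apply: le_trans (ler_normD _ _) _; rewrite !normrM.
    rewrite !normr_invX normrN normr_nat.
    apply: lerD; rewrite ler_wpM2r ?nat_pow_ge0// ler_pM//;
      by [exact: half_pole_sum_le | exact: half_pole_sumN_le].
  move=> n n0; apply: cvgD; apply: cvgMr_tmp; apply: cvgM;
    by [exact: cvg_half_pole_sum | exact: cvg_half_pole_sumN].
rewrite -(cvg_lim (@Rhausdorff R) (cvg_residue_sum_value p11 p21 q1)).
rewrite (cvg_lim (@Rhausdorff R) fg); apply/esym/cvg_lim => //.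
have -> : psum g = (fun n =>
    (1 + (-1) ^+ q) * ttilde R p1 * ttilde R p2 * psum (fun k => (k%:R : R) ^- q) n
  + ((-1) ^+ p2 - (-1) ^+ q) * ttilde R p1 * psum (fun k => H p2 k / k%:R ^+ q) n
  + ((-1) ^+ p1 - (-1) ^+ q) * ttilde R p2 * psum (fun k => H p1 k / k%:R ^+ q) n
  + ((-1) ^+ (p1 + p2) + (-1) ^+ q) * psum (fun k => H p1 k * H p2 k / k%:R ^+ q) n).
  apply/funext => n; rewrite -!psumZ -!psumD; apply: eq_bigr => k _.
  by rewrite /g invrXN exprD; ring.
apply: cvgD; last by apply: cvgMl_tmp.
apply: cvgD; last by apply: cvgMl_tmp; exact: c1.
apply: cvgD; last by apply: cvgMl_tmp; exact: c1.
by apply: cvgMl_tmp; exact: cvg_zeta.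
Qed.

End ResidueIdentity.

(** * Reindexing finite sums into the stated form *)

Section Reindexing.
Variable R : realType.
Implicit Types (p q m n k l : nat) (X : nat -> nat -> R).

Lemma sum_nat_unique m n a (P : pred nat) (F : nat -> R) :
  (m <= a < n)%N -> (forall k, (m <= k < n)%N -> P k = (k == a)) ->
  \sum_(m <= k < n | P k) F k = F a.
Proof.
move=> aI PE; rewrite big_nat_cond (eq_bigl (pred1 a)).
  by rewrite -big_filter filter_pred1_uniq ?big_seq1 ?iota_uniq ?mem_index_iota.
move=> k /=; case: (boolP (m <= k < n)%N) => [/PE //|kI].
by apply/esym; apply: contraNF kI => /eqP ->.
Qed.

Lemma sum_nat_none m n (P : pred nat) (F : nat -> R) :
  (forall k, (m <= k < n)%N -> P k = false) -> \sum_(m <= k < n | P k) F k = 0.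
Proof.
move=> PE; rewrite big_nat_cond big_pred0// => k.
by case: (boolP (m <= k < n)%N) => // /PE.
Qed.

(** Insert the indicator of [j = i + i'], exchange the sums, and let the indicator select
    [i' = j - i]. *)
Lemma sum_antidiagonals q X :
    (forall i j, (q <= i + j)%N -> X i j = 0) ->
  \sum_(0 <= i < q.+1) \sum_(0 <= j < q.+1) X i j
  = \sum_(j < q) \sum_(i < j.+1) X i (j - i)%N.
Proof.
move=> X0; transitivity (\sum_(0 <= i < q.+1) \sum_(0 <= i' < q.+1)
    \sum_(0 <= j < q) (if j == (i + i')%N then X i i' else 0)).
  apply: eq_bigr => i _; apply: eq_bigr => i' _; rewrite -big_mkcond.
  have [qi|qi] := leqP q (i + i')%N.
    by rewrite sum_nat_none ?X0// => k; lia.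
  by rewrite (@sum_nat_unique _ _ (i + i')%N).
under eq_bigr do rewrite exchange_big/=.
rewrite exchange_big/= big_mkord; apply: eq_bigr => j _.
rewrite -(big_mkord predT (fun i => X i (j - i)%N)).
rewrite (@big_nat_widen _ _ _ 0 j.+1 q.+1) ?ltnS ?(ltnW (ltn_ord j))//.
rewrite [RHS]big_mkcond/=.
apply: eq_big_nat => i _; rewrite -big_mkcond/=.
have [ij|ij] := ltnP i j.+1.
  rewrite (@sum_nat_unique _ _ (j - i)%N) ?leq0n//=; first by have := ltn_ord j; lia.
  by move=> k _; apply/eqP/eqP; lia.
by rewrite sum_nat_none// => k _; apply/eqP; lia.
Qed.

(** Substitute [l = r - 1 - i]. The sign comes from [1 + (-1) ^+ (l + 1) = - ((-1) ^+ l - 1)], and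
    the binomial is replaced by its symmetric form. *)
Lemma sum_pole_orders (q r : nat) (t : nat -> R) (T : nat -> R) : (0 < q)%N ->
  \sum_(i < r) 'C((q + i).-1, i)%:R * even_part t (r - i) * T (q + i)%N
  = - \sum_(0 <= l < r) ((-1) ^+ l - 1) * 'C(r + q - l - 2, q - 1)%:R
      * t (l + 1)%N * T (r + q - l - 1)%N.
Proof.
move=> q0; rewrite (reindex_inj rev_ord_inj) -sumrN big_mkord; apply: eq_bigr => l _ /=.
have lr := ltn_ord l.
have -> : (r - (r - l.+1) = l + 1)%N by lia.
have -> : (q + (r - l.+1) = r + q - l - 1)%N by lia.
have -> : 'C((r + q - l - 1).-1, r - l.+1) = 'C(r + q - l - 2, q - 1).
  rewrite -bin_sub; last by lia.
  by congr 'C(_, _); lia.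
by rewrite /even_part exprD expr1; ring.
Qed.

Lemma thetaE p i : (0 < p)%N ->
  theta R p i = 'C(i.+1 + p - 2, p - 1)%:R * ttilde R (i.+1 + p - 1).
Proof.
move=> p0; rewrite /theta.
have -> : (i.+1 + p - 1 = p + i)%N by lia.
have -> : 'C(i.+1 + p - 2, p - 1) = 'C((p + i).-1, i).
  rewrite -bin_sub; last by lia.
  by congr 'C(_, _); lia.
by [].
Qed.

(** Only [k3 = (q - i - j) / 2] can contribute, and it is admissible exactly when [q - i - j] is
    positive and even. *)
Lemma double_sum_zeta q i j :
  2 * \sum_(1 <= k3 < q.+2 | (i.+1 + j.+1 + 2 * k3 == q + 2)%N) zeta R (2 * k3)
  = if (i + j < q)%N then even_part (zeta R) (q - (i + j)) else 0.
Proof.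
have [ijq|ijq] := ltnP; last first.
  by rewrite sum_nat_none ?mulr0// => k k0; apply/eqP; lia.
have [d dE] : exists d, (q = i + j + d)%N by exists (q - (i + j))%N; lia.
have -> : (q - (i + j) = d)%N by lia.
rewrite /even_part -signr_odd.
have [od|ed] := boolP (odd d).
  rewrite sum_nat_none ?expr1 ?subrr ?mulr0 ?mul0r// => k k0.
  by apply/eqP; lia.
have d2 : d = (2 * d./2)%N by lia.
rewrite (@sum_nat_unique _ _ d./2) ?expr0 -?d2//; first by lia.
by move=> k k0; apply/eqP/eqP; lia.
Qed.

Lemma res0_theta p1 p2 q : (0 < p1)%N -> (0 < p2)%N ->
  res0 (even_part (zeta R)) q (conv (theta R p1) (theta R p2)) =
  - (\sum_(1 <= k1 < q.+2) \sum_(1 <= k2 < q.+2 | (k1 + k2 == q + 2)%N)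
        'C(k1 + p1 - 2, p1 - 1)%:R * 'C(k2 + p2 - 2, p2 - 1)%:R
        * ttilde R (k1 + p1 - 1) * ttilde R (k2 + p2 - 1))
  + 2 * (\sum_(1 <= k1 < q.+2) \sum_(1 <= k2 < q.+2)
       \sum_(1 <= k3 < q.+2 | (k1 + k2 + 2 * k3 == q + 2)%N)
        'C(k1 + p1 - 2, p1 - 1)%:R * 'C(k2 + p2 - 2, p2 - 1)%:R
        * ttilde R (k1 + p1 - 1) * ttilde R (k2 + p2 - 1) * zeta R (2 * k3)).
Proof.
move=> p10 p20; rewrite /res0; congr (- _ + _).
  rewrite big_add1 big_mkord; apply: eq_bigr => i _.
  move: (nat_of_ord i) (ltn_ord i) => {}i iq.
  rewrite (@sum_nat_unique _ _ (q - i).+1); [|lia|by move=> k k0; apply/eqP/eqP; lia].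
  by rewrite !thetaE//; ring.
(* The triangle [i + j < q] is completed by zeros to the box of the pairs
   [(k1, k2) = (i + 1, j + 1)]. *)
transitivity (\sum_(0 <= i < q.+1) \sum_(0 <= j < q.+1)
    theta R p1 i * theta R p2 j
    * (if (i + j < q)%N then even_part (zeta R) (q - (i + j)) else 0)).
  rewrite sum_antidiagonals => [|i j ijq]; last by rewrite ltnNge ijq mulr0.
  apply: eq_bigr => j _; rewrite /conv mulr_suml; apply: eq_bigr => i _.
  by have := ltn_ord i; rewrite ltnS => ij; rewrite subnKC// ltn_ord.
rewrite mulr_sumr big_add1; apply: eq_bigr => i _.
rewrite mulr_sumr big_add1; apply: eq_bigr => j _.
rewrite -double_sum_zeta [LHS]mulrCA; congr (_ * _).
by rewrite mulr_sumr; apply: eq_bigr => k _; rewrite !thetaE//; ring.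
Qed.

(** With [k = i + 1], the sign change from [(-1) ^+ i] to [(-1) ^+ k] absorbs the minus sign of
    [sum_pole_orders]. *)
Lemma cross_valueE p p' q : (0 < p')%N -> (0 < q)%N ->
  cross_value R p p' q =
  \sum_(1 <= k < p.+1) (-1) ^+ k * 'C(k + p' - 2, p' - 1)%:R *
    (\sum_(0 <= l < (p - k).+1)
      ((-1) ^+ l - 1) * 'C(p + q - k - l - 1, q - 1)%:R * ttilde R (l + 1)
      * cross_limit R (k + p' - 1) (p + q - k - l)).
Proof.
move=> p'0 q0; rewrite /cross_value big_add1 big_mkord; apply: eq_bigr => i _.
have ip := ltn_ord i.
rewrite (sum_pole_orders _ _ (fun s => cross_limit R (p' + i) s))//.
have -> : (i.+1 + p' - 1 = p' + i)%N by lia.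
have -> : 'C(i.+1 + p' - 2, p' - 1) = 'C((p' + i).-1, i).
  rewrite -bin_sub; last by lia.
  by congr 'C(_, _); lia.
have -> : (p - i = (p - i.+1).+1)%N by lia.
rewrite [(-1) ^+ i.+1]exprS mulN1r !mulNr mulrN; congr (- (_ * _)).
apply: eq_big_nat => l lI.
have -> : ((p - i.+1).+1 + q - l - 2 = p + q - i.+1 - l - 1)%N by lia.
by have -> : ((p - i.+1).+1 + q - l - 1 = p + q - i.+1 - l)%N by lia.
Qed.

End Reindexing.

(** * Assembly of the parity formula *)

Theorem theorem4p5 (R : realType) (p1 p2 q : nat)
    (hp1 : (1 < p1)%N) (hp2 : (1 < p2)%N) (hq : (1 < q)%N) :
  (1 + (-1) ^+ (p1 + p2 + q)) * Shat2 R p1 p2 q =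
    - (-1) ^+ (p1 + p2) * (1 + (-1) ^+ q) * ttilde R p1 * ttilde R p2 * zeta R q
    + (-1) ^+ p1 * ((-1) ^+ (p2 + q) - 1) * ttilde R p1 * Shat R p2 q
    + (-1) ^+ p2 * ((-1) ^+ (p1 + q) - 1) * ttilde R p2 * Shat R p1 q
    - (-1) ^+ (p1 + p2) *
      (\sum_(1 <= k1 < q.+2) \sum_(1 <= k2 < q.+2 | (k1 + k2 == q + 2)%N)
        'C(k1 + p1 - 2, p1 - 1)%:R * 'C(k2 + p2 - 2, p2 - 1)%:R
        * ttilde R (k1 + p1 - 1) * ttilde R (k2 + p2 - 1))
    + 2 * (-1) ^+ (p1 + p2) *
      (\sum_(1 <= k1 < q.+2) \sum_(1 <= k2 < q.+2)
       \sum_(1 <= k3 < q.+2 | (k1 + k2 + 2 * k3 == q + 2)%N)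
        'C(k1 + p1 - 2, p1 - 1)%:R * 'C(k2 + p2 - 2, p2 - 1)%:R
        * ttilde R (k1 + p1 - 1) * ttilde R (k2 + p2 - 1) * zeta R (2 * k3))
    - (-1) ^+ (p1 + p2) *
      (\sum_(0 <= l < p1 + p2)
        ((-1) ^+ l - 1) * 'C(p1 + p2 + q - l - 2, q - 1)%:R
        * ttilde R (l + 1) * ttilde R (p1 + p2 + q - l - 1))
    + (-1) ^+ (p1 + p2) *
      (\sum_(1 <= k < p2.+1) (-1) ^+ k * 'C(k + p1 - 2, p1 - 1)%:R *
        (\sum_(0 <= l < (p2 - k).+1)
          ((-1) ^+ l - 1) * 'C(p2 + q - k - l - 1, q - 1)%:R * ttilde R (l + 1)
          * (zeta R (k + p1 - 1) * ttilde R (p2 + q - k - l)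
             + (-1) ^+ (k + p1 - 1) *
               \sum_(1 <= n <oo) (harmonic_sum R (k + p1 - 1) (n - 1)
                                  / (n%:R - 2^-1) ^+ (p2 + q - k - l)))))
    + (-1) ^+ (p1 + p2) *
      (\sum_(1 <= k < p1.+1) (-1) ^+ k * 'C(k + p2 - 2, p2 - 1)%:R *
        (\sum_(0 <= l < (p1 - k).+1)
          ((-1) ^+ l - 1) * 'C(p1 + q - k - l - 1, q - 1)%:R * ttilde R (l + 1)
          * (zeta R (k + p2 - 1) * ttilde R (p1 + q - k - l)
             + (-1) ^+ (k + p2 - 1) *
               \sum_(1 <= n <oo) (harmonic_sum R (k + p2 - 1) (n - 1)
                                  / (n%:R - 2^-1) ^+ (p1 + q - k - l))))).
Proof.
have := Shat_residue R hp1 hp2 hq; rewrite /residue_value.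
rewrite res0_theta ?(ltnW hp1) ?(ltnW hp2)//.
rewrite !cross_valueE ?(ltnW hp1) ?(ltnW hp2) ?(ltnW hq)//.
under [X in _ = _ + X + _ + _]eq_bigr do rewrite mulrAC.
rewrite (sum_pole_orders _ _ (ttilde R)) ?(ltnW hq)//.
rewrite /cross_limit /half.
move: (Shat2 _ _ _ _) (Shat _ _ _) (Shat _ _ _) => S2 S1 S1'.
do 5!(move: (\sum_(_ <= _ < _) _) => ?).
move: (ttilde R p1) (ttilde R p2) (zeta R q) => t1 t2 z.
rewrite !exprD.
(* The goal is the residue identity times [(-1) ^+ (p1 + p2)]; once the parities of [p1] and [p2]
   are fixed, it follows linearly. *)
rewrite -[(-1) ^+ p1]signr_odd -[(-1) ^+ p2]signr_odd.
by case: (odd p1); case: (odd p2); rewrite ?expr0 ?expr1; lra.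
Qed.
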